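(* Let $G$ be a finite undirected graph (possibly with loops and multiple edges) with nonempty vertex set $V$ and edge set $E$, and let $b\in\mathbb{R}^V$ have all entries nonnegative. An element $u$ of $\mathcal{P}(G,b)$ is a vertex of the polytope $\mathcal{P}(G,b)$ if and only if each component of the graph $\mathrm{gr}(u)$ of $u$ either is acyclic or else contains exactly one cycle with that cycle having odd length.
   Context: $\delta_G(v)$ denotes the set of edges of $G$ incident with $v$; a loop at $v$ appears once in $\delta_G(v)$. $\mathcal{P}(G,b)=\{x\in\mathbb{R}^E \mid x_e\ge 0 \text{ for each } e\in E,\ \sum_{e\in\delta_G(v)}x_e=b_v \text{ for each } v\in V\}$ (when $E=\emptyset$, $\mathbb{R}^\emptyset=\{0\}$, so it is $\{0\}$ if $b=0$ and $\emptyset$ otherwise). For $x\in\mathcal{P}(G,b)$, the graph $\mathrm{gr}(x)$ of $x$ is the spanning subgraph of $G$ (vertex set $V$) with edge set $\{e\in E\mid x_e>0\}$. A cycle of length 1 is a vertex together with a loop attached to it, and a cycle of length 2 is two distinct vertices together with two distinct edges connecting them. The choice between the two alternatives is made independently for each component. *)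

(* Defs.v *)
From mathcomp Require Import all_boot all_order all_algebra.
From mathcomp Require Import boolp classical_sets reals.

Set Implicit Arguments.
Unset Strict Implicit.
Unset Printing Implicit Defensive.

Import Order.TTheory GRing.Theory Num.Theory.

Local Open Scope ring_scope.

(** An edge [e] has one endpoint exactly when it is a loop.  Distinct edges may
    have the same set of endpoints. *)
Record multigraph (V E : finType) := Multigraph {
  ends : E -> {set V};
  card_ends : forall e : E, (0 < #|ends e| <= 2)%N
}.

(** A loop at [v] occurs once in [incident G v]. *)
Definition incident (V E : finType) (G : multigraph V E) (v : V) : {set E} :=
  [set e : E | v \in ends G e].

Definition graph_polytope (R : realType) (V E : finType) (G : multigraph V E)
    (b : {ffun V -> R}) : set {ffun E -> R} :=
  fun x => (forall e : E, 0 <= x e)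
    /\ (forall v : V, \sum_(e in incident G v) x e = b v).

(** [F] is cut out of [P] by the hyperplane of an inequality [c . x <= beta]
    valid on [P]; [c = 0] gives the faces [P] and the empty set. *)
Definition is_face (R : realType) (E : finType) (P F : set {ffun E -> R}) : Prop :=
  exists (c : {ffun E -> R}) (beta : R),
    (forall x, P x -> \sum_(e : E) c e * x e <= beta)
    /\ (forall x, F x <-> P x /\ \sum_(e : E) c e * x e = beta).

(** A vertex is a face of dimension zero, that is, a face with one point. *)
Definition is_vertex (R : realType) (E : finType) (P : set {ffun E -> R})
    (u : {ffun E -> R}) : Prop :=
  is_face P [set u]%classic.

(** A vertex set and an edge set; no condition is imposed here, but all the
    pairs defined below contain the endpoints of their edges. *)
Definition subgraph (V E : finType) : Type := ({set V} * {set E})%type.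

Definition support_graph (R : realType) (V E : finType) (G : multigraph V E)
    (x : {ffun E -> R}) : subgraph V E :=
  ([set: V], [set e : E | 0 < x e]).

Definition adjacent (V E : finType) (G : multigraph V E) (H : subgraph V E) : rel V :=
  fun v w => [exists e in H.2, ends G e == [set v; w]].

Definition component_of (V E : finType) (G : multigraph V E) (H : subgraph V E)
    (v : V) : subgraph V E :=
  let W := [set w in H.1 | connect (adjacent G H) v w] in
  (W, [set e in H.2 | ends G e \subset W]).

Definition is_component (V E : finType) (G : multigraph V E) (H K : subgraph V E) :
    Prop :=
  exists2 v : V, v \in H.1 & K = component_of G H v.

(** [C] consists of distinct vertices [v_0, ..., v_(k-1)] and distinct edges
    [e_0, ..., e_(k-1)], where [k >= 1] and [e_i] joins [v_i] to
    [v_(i+1 mod k)].  For [k = 1] this is a vertex with a loop, and for [k = 2]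
    two vertices with two parallel edges.  A cycle is a subgraph: neither its
    starting point nor its direction is part of it. *)
Definition is_cycle (V E : finType) (G : multigraph V E) (C : subgraph V E) : Prop :=
  exists (k : nat) (v : 'I_k -> V) (e : 'I_k -> E),
    [/\ (0 < k)%N, injective v, injective e,
        (forall i : 'I_k, ends G (e i) = [set v i; v (ordS i)])
      & C = ([set v i | i : 'I_k], [set e i | i : 'I_k])].

Definition cycle_in (V E : finType) (G : multigraph V E) (H C : subgraph V E) : Prop :=
  [/\ is_cycle G C, C.1 \subset H.1 & C.2 \subset H.2].

Definition cycle_length (V E : finType) (C : subgraph V E) : nat := #|C.2|.

Definition acyclic (V E : finType) (G : multigraph V E) (H : subgraph V E) : Prop :=
  forall C : subgraph V E, ~ cycle_in G H C.

Definition has_unique_cycle_odd (V E : finType) (G : multigraph V E)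
    (H : subgraph V E) : Prop :=
  exists C : subgraph V E,
    [/\ cycle_in G H C, (forall C', cycle_in G H C' -> C' = C)
      & odd (cycle_length C)].

(* Main.v *)
(* The point u is a vertex iff no nonzero y supported on supp u satisfies
   sum_(e at v) y_e = 0 for all v.  Alternating signs along a closed walk of
   even length give such a y.  Along an odd cycle through v they give 2 delta_v,
   so two odd cycles of a component, combined with twice the alternating sums
   along paths joining them to a common vertex, give another; it does not vanish
   because, up to the weight 2 of loops, it is integral and odd on the symmetric
   difference of the cycles.  Conversely, on an acyclic graph a y whose vertex
   sums vanish off one vertex r is zero: deleting an edge separates one of its
   endpoints a from r, and induction applies to the component of a, with root a.
   If there is a single cycle and it is odd, subtracting from y a multiple of its
   alternating sum reduces to the acyclic case. *)

Require Import Defs.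
From mathcomp Require Import all_boot all_order all_algebra.
From mathcomp Require Import boolp classical_sets reals.
From mathcomp Require Import zify ring lra.
From mathcomp Require Import fintype finset.

Set Implicit Arguments.
Unset Strict Implicit.
Unset Printing Implicit Defensive.

Import Order.TTheory GRing.Theory Num.Theory.
Local Open Scope ring_scope.

(** * Vertex sums, and alternating sums along walks *)

Definition boundary (R : realType) (V E : finType) (G : multigraph V E)
    (y : E -> R) (v : V) : R :=
  \sum_(e in incident G v) y e.

Definition supported (R : realType) (E : finType) (F : {set E}) (y : E -> R) : Prop :=
  forall e, e \notin F -> y e = 0.

Definition kernel_trivial (R : realType) (V E : finType) (G : multigraph V E)
    (F : {set E}) : Prop :=
  forall y : E -> R, supported F y -> (forall v, boundary G y v = 0) ->
  forall e, y e = 0.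

Definition walk (V E : finType) (G : multigraph V E) (F : {set E}) (k : nat)
    (v : nat -> V) (e : nat -> E) : Prop :=
  forall i, (i < k)%N -> e i \in F /\ ends G (e i) = [set v i; v i.+1].

(** Integer-valued, so that parity can later show a combination to be nonzero. An edge traversed
    several times collects all its signs. *)
Definition alternating_sum (E : finType) (k : nat) (e : nat -> E) (f : E) : int :=
  \sum_(i < k) (-1) ^+ i * (e i == f)%:R.

(* A loop counts once in the boundary, but has to contribute to both of its
   coinciding endpoints in a walk, hence the weight 2 for loops. *)
Definition weighted (R : realType) (V E : finType) (G : multigraph V E)
    (f : E -> int) (e : E) : R :=
  (f e)%:~R * (2 / #|ends G e|%:R).

Section Boundary.
Context {R : realType} {V E : finType} (G : multigraph V E).
Implicit Types (y z : E -> R) (F : {set E}) (v w x : V) (e f : E).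

Lemma boundaryD y z v :
  boundary G (fun e => y e + z e) v = boundary G y v + boundary G z v.
Proof. exact: big_split. Qed.

Lemma boundaryZ (c : R) y v :
  boundary G (fun e => c * y e) v = c * boundary G y v.
Proof. by rewrite /boundary big_distrr. Qed.

Lemma eq_boundary y z v : y =1 z -> boundary G y v = boundary G z v.
Proof. by move=> yz; apply: eq_bigr => e _. Qed.

Lemma boundary_single (c : R) e v :
  boundary G (fun f => c *+ (f == e)) v = c *+ (v \in ends G e).
Proof.
rewrite /boundary big_mkcond (bigD1 e) //= big1 ?addr0; last first.
  by move=> f /negbTE ->; rewrite mulr0n; case: ifP.
by rewrite eqxx inE; case: (v \in _).
Qed.

Lemma ends_pair e : exists a b, ends G e = [set a; b].
Proof.
have /andP[] := card_ends G e; move=> c0; rewrite leq_eqVlt => /orP[/cards2P[a [b [_ ->]]]|c2].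
  by exists a, b.
have /eqP/cards1P[a ->] : #|ends G e| = 1%N by lia.
by exists a, a; rewrite setUid.
Qed.

Lemma weighted_incidence v a b :
  (2 / #|[set a; b]|%:R) *+ (v \in [set a; b]) = (v == a)%:R + (v == b)%:R :> R.
Proof.
rewrite cards2 in_set2; case: (eqVneq a b) => [->|ab] /=.
  by case: (v == b) => /=; rewrite ?mulr0n ?mulr1n ?addr0 ?divr1.
case: (eqVneq v a) => [->|_] /=; last first.
  by case: (v == b); rewrite ?mulr0n ?mulr1n ?divff ?add0r ?pnatr_eq0.
by rewrite (negbTE ab) mulr1n divff ?addr0 ?pnatr_eq0.
Qed.

(** Telescoping: step [i] adds [(-1) ^+ i] at both [v i] and [v i.+1], and the contributions of
    consecutive steps cancel at their common vertex. A closed walk thus gives 0 if its length is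
    even and 2 at its base vertex if odd. *)
Lemma boundary_walk F k (v : nat -> V) (e : nat -> E) x : walk G F k v e ->
  boundary G (weighted R G (alternating_sum k e)) x =
  (x == v 0)%:R - (-1) ^+ k * (x == v k)%:R.
Proof.
elim: k => [|k IH] wk.
  rewrite expr0 mul1r subrr /boundary big1 // => f _.
  by rewrite /weighted /alternating_sum big_ord0 mul0r.
have /IH {}IH : walk G F k v e by move=> i ik; apply: wk; lia.
have [_ ek] := wk k (ltnSn k).
rewrite (@eq_boundary _ (fun f => weighted R G (alternating_sum k e) f +
    (-1) ^+ k * (2 / #|ends G (e k)|%:R) *+ (f == e k))); last first.
  move=> f; rewrite /weighted /alternating_sum big_ord_recr /= rmorphD /= mulrDl.
  congr (_ + _); rewrite eq_sym rmorphM rmorphXn /= rmorphN1.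
  by case: eqVneq => [->|_]; rewrite ?mulr1 ?mulr0 ?mul0r ?mulr0n.
rewrite boundaryD IH boundary_single ek -mulrnAr weighted_incidence exprS.
ring.
Qed.

Lemma alternating_sum_notin k (e : nat -> E) f :
  (forall i, (i < k)%N -> e i != f) -> alternating_sum k e f = 0.
Proof.
by move=> ef; apply: big1 => i _; rewrite (negbTE (ef i _)) ?mulr0.
Qed.

Lemma alternating_sum_in k (e : nat -> E) j :
  {in [pred i | (i < k)%N] &, injective e} -> (j < k)%N ->
  alternating_sum k e (e j) = (-1) ^+ j.
Proof.
move=> inj jk; rewrite /alternating_sum (bigD1 (Ordinal jk)) //= eqxx mulr1.
rewrite big1 ?addr0 // => i ij; case: eqP => [/inj|_]; last by rewrite mulr0.
by rewrite !inE => /(_ (ltn_ord i) jk) ij'; case/eqP: ij; apply: val_inj.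
Qed.

Lemma supported_walk F k (v : nat -> V) (e : nat -> E) : walk G F k v e ->
  supported F (weighted R G (alternating_sum k e)).
Proof.
move=> wk f fF; rewrite /weighted alternating_sum_notin ?mul0r // => i ik.
by apply: contraNneq fF => <-; case: (wk i ik).
Qed.

Lemma weighted_eq0 (f : E -> int) e : weighted R G f e = 0 -> f e = 0.
Proof.
move=> /eqP; rewrite mulf_eq0 intr_eq0 => /orP[/eqP//|].
rewrite mulf_eq0 pnatr_eq0 /= invr_eq0 pnatr_eq0.
by have /andP[/lt0n_neq0/negbTE->] := card_ends G e.
Qed.

End Boundary.

(** * Walks, cycles and components *)

Section Cycles.
Context {V E : finType} (G : multigraph V E).
Implicit Types (F : {set E}) (H K C : subgraph V E) (v w x : V) (e f : E).

(** Generalizes the support graph to any edge set, so that an induction can delete edges. *)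
Definition spanning F : subgraph V E := ([set: V], F).

Definition cycle_free F : Prop := forall C, is_cycle G C -> ~ (C.2 \subset F).

Lemma adjacent_sym H : symmetric (adjacent G H).
Proof. by move=> v w; apply: eq_existsb => e; rewrite setUC. Qed.

Lemma connect_adjacent_sym H : connect_sym (adjacent G H).
Proof. exact: sym_connect_sym (adjacent_sym H). Qed.

Lemma connect_walk F e0 a b : connect (adjacent G (spanning F)) a b ->
  exists k (v : nat -> V) (e : nat -> E),
  [/\ walk G F k v e, v 0 = a, v k = b &
      {in [pred i | (i <= k)%N] &, injective v}].
Proof.
case/connectP => p0 /shortenP[p pth uq _] ->.
pose v i := nth a (a :: p) i.
(* The choice succeeds at every index below [size p], so [e0] never enters the walk itself. *)
pose e i := odflt e0 [pick f in F | ends G f == [set v i; v i.+1]].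
exists (size p), v, e; split => //.
- move=> i ik; have /existsP[f /andP[fF fe]] := pathP a pth i ik.
  rewrite /e; case: pickP => [g /andP[gF /eqP ge]//|/(_ f)].
  by rewrite /v /= fF fe.
- by rewrite /v -last_nth.
- by move=> i j; rewrite !inE => ik jk /eqP; rewrite nth_uniq ?ltnS // => /eqP.
Qed.

(** The edge [e] closes a simple path from [a] to [b]. If [a = b], the path has length 0 and the
    cycle is the loop [e]. *)
Lemma connect_cycle F e a b : connect (adjacent G (spanning F)) a b ->
  e \notin F -> ends G e = [set a; b] ->
  exists2 C, is_cycle G C & C.2 \subset e |: F.
Proof.
move=> /(connect_walk e)[k [v [e' [wk v0 vk injv]]]] eF ee.
pose c (i : 'I_k.+1) := if (i < k)%N then e' i else e.
have cF i : c i \in e |: F.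
  rewrite /c in_setU1; case: ltnP => [ik|_]; last by rewrite eqxx.
  by have [-> _] := wk i ik; rewrite orbT.
pose C : subgraph V E := ([set v i | i : 'I_k.+1], [set c i | i : 'I_k.+1]).
exists C; last by apply/subsetP => _ /imsetP[i _ ->].
exists k.+1, (fun i : 'I_k.+1 => v i), c; split => //.
- move=> i j /injv; rewrite !inE => ij.
  by apply/val_inj/ij; rewrite -ltnS.
- move=> i j; rewrite /c; have := ltn_ord i; have := ltn_ord j.
  case: (ltnP i k) => ik; case: (ltnP j k) => jk jk1 ik1 eij; apply: val_inj => /=.
  + have [_ ei] := wk i ik; have [_ ej] := wk j jk.
    (* Equal edges have equal ends, so by injectivity of [v] both [i] and [i.+1] lie in [{j, j.+1}],
       which forces [i = j]. *)
    have : v i \in [set v j; v j.+1] by rewrite -ej -eij ei set21.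
    have : v i.+1 \in [set v j; v j.+1] by rewrite -ej -eij ei set22.
    rewrite !in_set2 => /orP[]/eqP/injv; rewrite !inE => h1.
      by case/orP => /eqP/injv; rewrite !inE => h2; lia.
    by case/orP => /eqP/injv; rewrite !inE => h2; lia.
  + by have [] := wk i ik; rewrite eij (negbTE eF).
  + by have [] := wk j jk; rewrite -eij (negbTE eF).
  + lia.
- move=> i; rewrite /c /=; case: ltnP => ik.
    by rewrite modn_small ?ltnS //; have [_ ->] := wk i ik.
  have -> : i = k :> nat by have := ltn_ord i; lia.
  by rewrite modnn v0 vk setUC.
Qed.

(** Unrolls the cyclic indexing into a closed walk indexed by [nat], to which alternating sums
    apply. *)
Lemma cycle_walk C : is_cycle G C ->
  exists k (v : nat -> V) (e : nat -> E),
  [/\ walk G C.2 k.+1 v e, v k.+1 = v 0, v 0 \in C.1,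
      {in [pred i | (i < k.+1)%N] &, injective e} &
      forall f, f \in C.2 -> exists2 i, (i < k.+1)%N & f = e i]
  /\ cycle_length C = k.+1.
Proof.
case=> k [v [e [k0 injv inje ee ->]]].
case: k k0 v e injv inje ee => [//|k] _ v e injv inje ee /=.
have inordK' i : (i < k.+1)%N -> (inord i : 'I_k.+1) = i :> nat
  by move=> ik; rewrite inordK.
exists k, (fun i => v (inord (i %% k.+1))), (fun i => e (inord i)).
split; last by rewrite /cycle_length card_imset // card_ord.
split.
- move=> i ik; split; first by apply: imset_f.
  rewrite ee modn_small //; congr [set _; v _]; apply: val_inj.
  by rewrite /= !inordK' // ltn_pmod.
- by rewrite modnn mod0n.
- exact: imset_f.
- move=> i j ik jk /inje/(congr1 val) /=; rewrite !inE in ik jk.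
  by rewrite !inordK'.
- by move=> _ /imsetP[i _ ->]; exists i => //; rewrite inord_val.
Qed.

(** Makes a cycle determined by its edges, so that uniqueness can be tested on edge sets. *)
Lemma cycle_vertices C : is_cycle G C -> C.1 = \bigcup_(e in C.2) ends G e.
Proof.
case=> k [v [e [_ _ _ ee ->]]] /=; apply/setP/subset_eqP/andP; split.
- apply/subsetP => _ /imsetP[i _ ->]; apply/bigcupP.
  by exists (e i); rewrite ?imset_f // ee set21.
- apply/bigcupsP => _ /imsetP[i _ ->]; rewrite ee.
  by apply/subsetP => x; rewrite in_set2 => /orP[]/eqP->; apply: imset_f.
Qed.

Lemma cycle_eq C C' : is_cycle G C -> is_cycle G C' -> C.2 = C'.2 -> C = C'.
Proof.
move=> cC cC' E2; rewrite (surjective_pairing C) (surjective_pairing C').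
by rewrite (cycle_vertices cC) (cycle_vertices cC') E2.
Qed.

Lemma component_edge F a x e : x \in (component_of G (spanning F) a).1 ->
  e \in F -> x \in ends G e -> e \in (component_of G (spanning F) a).2.
Proof.
rewrite !inE /= => ax eF xe; rewrite eF /=; apply/subsetP => y ye.
rewrite !inE /=; apply: connect_trans ax _.
have [->|xy] := eqVneq x y; first exact: connect0.
apply/connect1/existsP; exists e; rewrite eF eq_sym eqEcard subUset !sub1set xe ye.
by rewrite cards2 xy /=; have /andP[] := card_ends G e.
Qed.

Lemma cycle_in_component F a C : is_cycle G C ->
  C.2 \subset (component_of G (spanning F) a).2 ->
  cycle_in G (component_of G (spanning F) a) C.
Proof.
move=> cC sub; split=> //; rewrite (cycle_vertices cC).
by apply/bigcupsP => e /(subsetP sub); rewrite inE => /andP[].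
Qed.

End Cycles.

(** * Components and rooted forests *)

Lemma boundary_component (R : realType) (V E : finType) (G : multigraph V E)
    (F : {set E}) (y : E -> R) (a x : V) (K := component_of G (spanning F) a) :
  supported F y ->
  boundary G (fun e => if e \in K.2 then y e else 0) x =
  if x \in K.1 then boundary G y x else 0.
Proof.
move=> sy; rewrite /boundary; case: ifP => xK.
  apply: eq_bigr => e; rewrite inE => xe; case: ifP => // /negbT eK.
  rewrite sy //; apply: contra eK => eF; exact: component_edge xK eF xe.
apply: big1 => e; rewrite inE => xe; case: ifP => //.
rewrite [e \in K.2]inE => /andP[_ /subsetP/(_ _ xe)].
by rewrite [x \in _]xK.
Qed.

(** Leaving the sum at [r] free is what lets the induction run: deleting [e] disturbs the sum at its
    endpoint [a], which then becomes the root of its own component. *)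
Lemma cycle_free_kernel (R : realType) (V E : finType) (G : multigraph V E)
    (F : {set E}) (y : E -> R) (r : V) : cycle_free G F -> supported F y ->
  (forall x, x != r -> boundary G y x = 0) -> forall e, y e = 0.
Proof.
elim: {F}#|F| {-2}F (leqnn #|F|) y r => [|n IH] F Fn y r cF sy by0 e;
  have [eF|/sy//] := boolP (e \in F).
  by move: Fn; rewrite leqn0 cards_eq0 => /eqP F0; rewrite F0 inE in eF.
pose F' := F :\ e; pose cn := connect (adjacent G (spanning F')).
have eF' : e \notin F' by rewrite !inE eqxx.
have ncycle a b : ends G e = [set a; b] -> ~~ cn a b.
  move=> ee; apply/negP => ab; have [C cC] := connect_cycle ab eF' ee.
  by rewrite setD1K //; apply: cF.
(* If [r] is not on the side of [a], then [y] without [e] has zero sums on that side except at [a].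
   By induction it vanishes there, and the sum of [y] at [a] reduces to [y e]. *)
have key a b : ends G e = [set a; b] -> ~~ cn a r -> y e = 0.
  move=> ee ar; pose K := component_of G (spanning F') a.
  pose y1 f := y f - y e *+ (f == e).
  have sy1 : supported F' y1.
    move=> f; rewrite !inE negb_and negbK /y1.
    by case: eqVneq => [->|_] /=; rewrite ?subrr // subr0 => /sy.
  have y1E x : boundary G y1 x = boundary G y x - y e *+ (x \in ends G e).
    rewrite -mulNrn -boundary_single -boundaryD; apply: eq_boundary => f.
    by rewrite /y1 mulNrn.
  have aK : a \in K.1 by rewrite !inE connect0.
  have an_r : a != r by apply: contraNneq ar => ->; exact: connect0.
  pose y2 f := if f \in K.2 then y1 f else 0.
  have y2E x : boundary G y2 x = if x \in K.1 then boundary G y1 x else 0.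
    exact: boundary_component.
  have y20 : forall f, y2 f = 0.
    apply: (IH K.2 _ y2 a).
    - have : (#|K.2| <= #|F'|)%N by apply/subset_leq_card/subsetP => f; rewrite inE => /andP[].
      by rewrite /F'; have := cardsD1 e F; rewrite eF; lia.
    - move=> C cC /subsetP CK; apply: (cF C cC); apply/subsetP => f /CK.
      by rewrite !inE => /andP[/andP[]].
    - by move=> f /negbTE fK; rewrite /y2 fK.
    - move=> x xa; rewrite y2E; case: ifP => // xK; rewrite y1E.
      have axc : cn a x by move: xK; rewrite !inE.
      rewrite by0; last by apply: contraNneq ar => <-.
      rewrite ee in_set2 (negbTE xa) /=; case: eqP => [xb|_]; last by rewrite mulr0n subrr.
      by move: (ncycle _ _ ee); rewrite -xb axc.
  have := y2E a; rewrite aK y1E by0 // ee set21 mulr1n sub0r.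
  rewrite /boundary big1; last by move=> f _; exact: y20.
  by move/eqP; rewrite eq_sym oppr_eq0 => /eqP.
have [a [b ee]] := ends_pair G e.
(* The vertices [a] and [b] cannot both reach [r] without [e], since [e] would then close a
   cycle. *)
have [ar|/(key _ _ ee)//] := boolP (cn a r).
apply: (key b a); first by rewrite setUC.
apply: contra (ncycle _ _ ee) => br; apply: connect_trans ar _.
by rewrite connect_adjacent_sym.
Qed.

(** * Vertices of the polytope and the kernel *)

Lemma vertex_kernel (R : realType) (V E : finType) (G : multigraph V E)
    (b : {ffun V -> R}) (u : {ffun E -> R}) (u_in_P : graph_polytope G b u) :
  is_vertex (graph_polytope G b) u <->
  kernel_trivial R G [set e | 0 < u e].
Proof.
have [u0 ub] := u_in_P.
split=> [[c [beta [le_beta eq_beta]]] y sy y0|ker].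
  have [uP ubeta] := (eq_beta u).1 erefl.
  have [eps eps0 epsu] : exists2 eps : R, 0 < eps & forall e, eps * `|y e| <= u e.
    (* The summand 1 keeps the denominator positive where [y e = 0]; starting the minimum at 1
       covers an empty support. *)
    pose t e := u e / (1 + `|y e|).
    pose eps := \big[Num.min/1]_(e | 0 < u e) t e.
    have t0 e : 0 < u e -> 0 < t e by move=> ue; rewrite divr_gt0 // ltr_wpDr.
    exists eps.
      by apply: (big_ind (fun s => 0 < s)) => // p q p0 q0; rewrite lt_min p0.
    move=> e; have [ue|ue] := boolP (0 < u e); last first.
      by rewrite sy ?inE // normr0 mulr0.
    have le_t : eps <= t e by rewrite /eps (bigD1 e) //= ge_min lexx.
    apply: le_trans (_ : t e * (1 + `|y e|) <= _).
      apply: ler_pM => //; last by rewrite lerDr.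
      by apply: (big_ind (fun s => 0 <= s)) => // [p q p0 q0|f /t0/ltW //]; rewrite le_min p0.
    by rewrite divfK // gt_eqF // ltr_wpDr.
  pose x (s : R) : {ffun E -> R} := [ffun e => u e + s * y e].
  have xP s : `|s| <= eps -> graph_polytope G b (x s).
    move=> seps; split=> [e|v].
      rewrite ffunE -lerBlDl sub0r.
      apply: lerNnormlW; rewrite normrM; apply: le_trans (epsu e).
      exact: ler_wpM2r.
    transitivity (boundary G (fun e => u e + s * y e) v).
      by apply: eq_bigr => e _; rewrite ffunE.
    by rewrite boundaryD boundaryZ y0 mulr0 addr0; exact: ub.
  pose d := \sum_e c e * y e.
  have xE s : \sum_e c e * x s e = beta + s * d.
    rewrite -ubeta /d big_distrr -big_split /=.
    by apply: eq_bigr => e _; rewrite ffunE; ring.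
  have xp : graph_polytope G b (x eps) by apply: xP; rewrite gtr0_norm.
  have xn : graph_polytope G b (x (- eps)) by apply: xP; rewrite normrN gtr0_norm.
  (* Validity of the inequality at both [eps] and [- eps] forces [eps * d = 0], so [x eps] also lies
     on the face. *)
  have := le_beta _ xp; have := le_beta _ xn; rewrite !xE => h1 h2.
  have xu : x eps = u by apply/(eq_beta _); split => //; rewrite xE; lra.
  move=> e; have := congr1 (fun g : {ffun E -> R} => g e) xu; rewrite ffunE => h.
  have /eqP : eps * y e = 0 by lra.
  by rewrite mulf_eq0 gt_eqF //= => /eqP.
(* This cuts out the points of the polytope that vanish wherever [u] does; their difference from [u]
   is in the kernel. *)
exists [ffun e => - (u e == 0)%:R], 0.
have le0 (x : {ffun E -> R}) : graph_polytope G b x ->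
    forall e, 0 <= (u e == 0)%:R * x e by case=> x0 _ e; rewrite mulr_ge0.
have sE (x : {ffun E -> R}) : \sum_e [ffun e => - (u e == 0)%:R] e * x e =
    - \sum_e (u e == 0)%:R * x e.
  by rewrite -sumrN; apply: eq_bigr => e _; rewrite ffunE mulNr.
split=> [x xP|x]; first by rewrite sE oppr_le0 sumr_ge0 // => e _; exact: le0.
split=> [->|[xP]].
  split=> //; rewrite sE big1 ?oppr0 // => e _.
  by case: eqP => [->|_]; rewrite ?mulr0 ?mul0r.
rewrite sE => /eqP; rewrite oppr_eq0 psumr_eq0; last by move=> e _; exact: le0.
move=> /allP x0; apply/ffunP => e; apply/eqP; rewrite -subr_eq0; apply/eqP.
apply: (ker (fun e => x e - u e)).
  move=> f; rewrite inE lt0r u0 andbT negbK => uf.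
  by have := x0 f (mem_index_enum f); rewrite uf mul1r (eqP uf) subr0 => /eqP.
move=> v; rewrite /boundary sumrB; have [_ ->] := xP.
by rewrite ub subrr.
Qed.

(** * The kernel and the cycles of components *)

Lemma kernel_components (R : realType) (V E : finType) (G : multigraph V E)
    (F : {set E}) (a : V) (K := component_of G (spanning F) a) :
  kernel_trivial R G F -> acyclic G K \/ has_unique_cycle_odd G K.
Proof.
move=> ker; have [ac|nac] := pselect (acyclic G K); [by left|right].
have KF (C : subgraph V E) : C.2 \subset K.2 -> C.2 \subset F.
  move=> CK; apply: (subset_trans CK); apply/subsetP => f.
  by rewrite inE => /andP[].
have wsub k v e (C : subgraph V E) : C.2 \subset K.2 -> walk G C.2 k v e -> walk G F k v e.
  move=> /KF/subsetP CF wk i /wk[ei ee]; split=> //; exact: CF.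
have oddC C : cycle_in G K C -> odd (cycle_length C).
  case=> cC _ CK; have [k [v [e [[wk vk _ inje _] ->]]]] := cycle_walk cC.
  case: (boolP (odd k.+1)) => // evk.
  have bd0 x : boundary G (weighted R G (alternating_sum k.+1 e)) x = 0.
    by rewrite (boundary_walk _ wk) vk -signr_odd (negbTE evk) mul1r subrr.
  (* The edges of a cycle are distinct, so nothing cancels and its first edge carries 1. *)
  have := ker _ (supported_walk (wsub _ _ _ _ CK wk)) bd0 (e 0%N).
  by move/weighted_eq0; rewrite alternating_sum_in.
have /existsNP[C /contrapT cC] : ~ forall C, ~ cycle_in G K C := nac.
exists C; split=> //; last exact: oddC.
move=> C' cC'; apply: contrapT => neC.
have [cC1 CK1 CK2] := cC; have [cC1' CK1' CK2'] := cC'.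
have [k [v [e [[wk vk v0 inje eC] lk]]]] := cycle_walk cC1.
have [k' [v' [e' [[wk' vk' v0' inje' eC'] lk']]]] := cycle_walk cC1'.
have := oddC _ cC; have := oddC _ cC'; rewrite lk lk' => ok' ok.
have /(connect_walk (e 0%N))[m [p [g [wp p0 pm _]]]] :
  connect (adjacent G (spanning F)) a (v 0%N).
  by have := subsetP CK1 _ v0; rewrite !inE.
have /(connect_walk (e 0%N))[m' [p' [g' [wp' p0' pm' _]]]] :
  connect (adjacent G (spanning F)) a (v' 0%N).
  by have := subsetP CK1' _ v0'; rewrite !inE.
(* The first cycle has sum 2 at [v 0], and the path [p] has 1 at [a] and [- (-1) ^+ m] at [v 0].
   With these coefficients each cycle with its path leaves just 2 at [a], and the difference is 0.
   The factor 2 keeps the paths out of the parity. *)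
pose z f : int := (-1) ^+ m * alternating_sum k.+1 e f
  + (- (-1) ^+ m') * alternating_sum k'.+1 e' f
  + (2 * alternating_sum m g f + (- 2) * alternating_sum m' g' f).
have zE : weighted R G z =1 (fun f =>
    ((-1) ^+ m * weighted R G (alternating_sum k.+1 e) f
    + (- (-1) ^+ m') * weighted R G (alternating_sum k'.+1 e') f)
    + (2 * weighted R G (alternating_sum m g) f
       + (- 2) * weighted R G (alternating_sum m' g') f)).
  move=> f; rewrite /weighted /z !(rmorphD, rmorphM, rmorphN, rmorphXn) /= rmorph1.
  ring.
have z0 f : z f = 0.
  apply: (@weighted_eq0 R _ _ G); apply: ker => [h hF|x].
    have s1 := supported_walk (R:=R) (wsub _ _ _ _ CK2 wk) hF.
    have s2 := supported_walk (R:=R) (wsub _ _ _ _ CK2' wk') hF.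
    have s3 := supported_walk (R:=R) wp hF.
    have s4 := supported_walk (R:=R) wp' hF.
    by rewrite zE s1 s2 s3 s4 !mulr0 !addr0.
  rewrite (eq_boundary _ _ zE) !boundaryD !boundaryZ.
  rewrite (boundary_walk _ wk) (boundary_walk _ wk').
  rewrite (boundary_walk _ wp) (boundary_walk _ wp').
  rewrite vk vk' p0 pm p0' pm' -(signr_odd _ k.+1) -(signr_odd _ k'.+1) ok ok'.
  ring.
have sgn n : (-1) ^+ n = 1 :> int \/ (-1) ^+ n = -1 :> int.
  by rewrite -signr_odd; case: odd; [right|left].
have inC (D : subgraph V E) n w d f : walk G D.2 n w d ->
    {in [pred i | (i < n)%N] &, injective d} ->
    (forall h, h \in D.2 -> exists2 i, (i < n)%N & h = d i) ->
    (f \in D.2 /\ alternating_sum n d f \in [:: 1; -1]) \/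
    (f \notin D.2 /\ alternating_sum n d f = 0).
  move=> wd injd dD; have [fD|fD] := boolP (f \in D.2); [left|right]; split => //.
    have [i ik ->] := dD f fD; rewrite alternating_sum_in //.
    by case: (sgn i) => ->.
  rewrite alternating_sum_notin // => i /wd[di _].
  by apply: contraNneq fD => <-.
apply: neC; apply: (@cycle_eq _ _ G) => //; apply/setP => f.
have := z0 f; rewrite /z.
(* z f is odd exactly when f lies on one of the two cycles but not the other. *)
case: (inC C _ _ _ f wk inje eC) => -[fC];
  case: (inC C' _ _ _ f wk' inje' eC') => -[fC'].
- by rewrite fC fC'.
- move=> -> ; rewrite !inE => /orP[]/eqP ->; case: (sgn m) => ->; lia.
- rewrite !inE => /orP[]/eqP -> ->; case: (sgn m') => ->; lia.
- by rewrite (negbTE fC) (negbTE fC').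
Qed.

Lemma components_kernel (R : realType) (V E : finType) (G : multigraph V E)
    (F : {set E}) :
  (forall a, let K := component_of G (spanning F) a in
    acyclic G K \/ has_unique_cycle_odd G K) ->
  kernel_trivial R G F.
Proof.
move=> comps y sy y0 e; have [eF|/sy//] := boolP (e \in F).
have [a [b ee]] := ends_pair G e.
pose K := component_of G (spanning F) a; pose yK f := if f \in K.2 then y f else 0.
have yK0 x : boundary G yK x = 0.
  by rewrite /yK boundary_component //; case: ifP.
have eK : e \in K.2.
  by apply: (@component_edge _ _ _ _ _ a) => //; rewrite ?ee ?set21 // !inE connect0.
have syK : supported K.2 yK by move=> f /negbTE fK; rewrite /yK fK.
suff : yK e = 0 by rewrite /yK eK.
have [acK|[C [[cC _ CK] uniqC oddC]]] := comps a.
  apply: (@cycle_free_kernel R _ _ G K.2 yK a) => // C cC CK.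
  exact/(acK C)/cycle_in_component.
have [k [v [c [[wk vk v0 injc _] lk]]]] := cycle_walk cC.
rewrite lk in oddC.
have [c0C c0e] := wk 0%N isT.
pose z := weighted R G (alternating_sum k.+1 c).
have bz x : boundary G z x = 2 * (x == v 0)%:R.
  rewrite (boundary_walk _ wk) vk -signr_odd oddC; ring.
have zc0 : z (c 0%N) != 0.
  apply/eqP => /weighted_eq0; rewrite alternating_sum_in //.
(* Chosen to cancel [yK] at [c 0], whose deletion destroys the only cycle. As [z] has zero vertex
   sums off [v 0], that vertex can be the root of the remaining forest. *)
pose t := - (yK (c 0%N) / z (c 0%N)).
have y'0 : forall f, yK f + t * z f = 0.
  apply: (@cycle_free_kernel R _ _ G (K.2 :\ c 0%N) _ (v 0%N)).
  - move=> C' cC' C'K; have C'C : C' = C.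
      apply: uniqC; apply: cycle_in_component => //.
      exact: subset_trans C'K (subD1set _ _).
    by have := subsetP C'K (c 0%N); rewrite C'C c0C !inE eqxx => /(_ isT).
  - move=> f; rewrite !inE negb_and negbK => /orP[/eqP->|fK].
      by rewrite /t mulNr divfK // subrr.
    have fK' : f \notin K.2 by rewrite inE.
    rewrite syK // /z (supported_walk wk) ?mulr0 ?addr0 //.
    by apply: contra fK' => /(subsetP CK).
  - by move=> x xv; rewrite boundaryD boundaryZ bz yK0 (negbTE xv) !mulr0 addr0.
(* The vertex sum of [yK + t z] at [v 0] is twice [t]. *)
have t0 : t = 0.
  have : boundary G (fun f => yK f + t * z f) (v 0%N) = 0 by apply: big1.
  rewrite boundaryD boundaryZ bz yK0 eqxx add0r mulr1.
  by move=> /eqP; rewrite mulf_eq0 pnatr_eq0 orbF => /eqP.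
by have := y'0 e; rewrite t0 mul0r addr0.
Qed.

Theorem theorem22 (R : realType) (V E : finType) (G : multigraph V E)
    (V_nonempty : (0 < #|V|)%N)
    (b : {ffun V -> R}) (b_ge0 : forall v : V, 0 <= b v)
    (u : {ffun E -> R}) (u_in_P : graph_polytope G b u) :
  is_vertex (graph_polytope G b) u <->
  (forall K : subgraph V E, is_component G (support_graph G u) K ->
     acyclic G K \/ has_unique_cycle_odd G K).
Proof.
rewrite (vertex_kernel u_in_P); split.
  by move=> ker _ [a _ ->]; exact: (kernel_components a ker).
move=> comps; apply: components_kernel => a; apply: comps.
by exists a; rewrite ?inE.
Qed.
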